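(* Let $a>0$, $M_0>0$, and let $\rho(x)=x^2+a$ on $\mathbb{R}$. Set $$a_{crit}=\tfrac14\,(3M_0)^{2/3}.$$ Let $[\alpha,\beta]$ be an interval of weighted mass $M_0$ with least weighted perimeter among all intervals of weighted mass $M_0$. If $a<a_{crit}$, then $[\alpha,\beta]$ straddles the origin, with $\alpha\beta=-a$. If $a\ge a_{crit}$, then $[\alpha,\beta]$ is symmetric about the origin, with $\alpha=-\beta$. The least weighted perimeter is $$P=\begin{cases}(3M_0)^{2/3}, & a\le a_{crit},\\[4pt] 2k+\dfrac{2a^2}{k}-2a, & a\ge a_{crit},\end{cases}$$ where $k>0$ is defined by $4k^{3/2}=3M_0+\sqrt{9M_0^2+16a^3}$.
   Context: For a density $\rho$ on $\mathbb{R}$, an interval $[\alpha,\beta]$ has weighted perimeter $\rho(\alpha)+\rho(\beta)$ and weighted mass $\int_\alpha^\beta\rho(x)\,dx$. *)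

(* Defs.v *)
From Stdlib Require Import Reals.
From Coquelicot Require Import Coquelicot.
Open Scope R_scope.

Definition weighted_perimeter (rho : R -> R) (alpha beta : R) : R :=
  rho alpha + rho beta.

(* [RInt] is the oriented Riemann integral and is total; it is the weighted
   mass of [alpha, beta] when alpha <= beta and rho is Riemann integrable
   there, e.g. for a continuous rho. *)
Definition weighted_mass (rho : R -> R) (alpha beta : R) : R :=
  RInt rho alpha beta.

Definition interval_of_mass (rho : R -> R) (M0 alpha beta : R) : Prop :=
  alpha <= beta /\ weighted_mass rho alpha beta = M0.

Definition least_perimeter_interval (rho : R -> R) (M0 alpha beta : R) : Prop :=
  interval_of_mass rho M0 alpha beta /\
  forall alpha' beta' : R, interval_of_mass rho M0 alpha' beta' ->
    weighted_perimeter rho alpha beta <= weighted_perimeter rho alpha' beta'.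

(* The minimum, not just the infimum: P is attained. *)
Definition is_least_perimeter (rho : R -> R) (M0 P : R) : Prop :=
  exists alpha beta : R,
    least_perimeter_interval rho M0 alpha beta /\
    weighted_perimeter rho alpha beta = P.

Definition quad_density (a x : R) : R := x ^ 2 + a.

Definition a_crit (M0 : R) : R := / 4 * Rpower (3 * M0) (2 / 3).

Definition is_k (a M0 k : R) : Prop :=
  0 < k /\ 4 * Rpower k (3 / 2) = 3 * M0 + sqrt (9 * M0 ^ 2 + 16 * a ^ 3).

(* Main.v *)
Require Import Defs.
From Stdlib Require Import Reals Lra.
From Coquelicot Require Import Coquelicot.
Open Scope R_scope.

(** Write [d = beta - alpha] for the length of an interval of mass [M0] and
    [c] for the cube root of [3 * M0].  In terms of [d] and the product
    [alpha * beta] the mass constraint reads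
    [d ^ 3 + 3 * d * (alpha * beta + a) = c ^ 3], and eliminating the product
    leaves the perimeter as the function [(d ^ 3 + 2 * c ^ 3) / (3 * d)] of the
    length alone ([perimeter_of_length]).  This function decreases up to
    [d = c], where it takes its minimum [c ^ 2].

    A length [d] occurs only if [(alpha + beta) ^ 2 >= 0], which in terms of [d]
    is [d ^ 3 / 4 + 3 * a * d <= c ^ 3] ([length_constraint]), with equality
    exactly for the symmetric interval.  As the left side increases with [d],
    the admissible lengths are those up to the length [D] of the symmetric
    interval.  The length [c] is admissible iff [c ^ 2 >= 4 * a], that is
    [a <= a_crit M0]; the mass constraint at [d = c] then says
    [alpha * beta = - a].  Otherwise [D <= c], the perimeter decreases on all
    admissible lengths, and the symmetric interval wins.  Its half-length solves
    a depressed cubic, and [k] is the square of Cardano's parameter for that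
    cubic ([cardano_half_length]). *)

(** * Mass and perimeter in terms of length *)

Lemma quad_mass (a alpha beta : R) :
  weighted_mass (quad_density a) alpha beta
  = (beta ^ 3 - alpha ^ 3) / 3 + a * (beta - alpha).
Proof.
  unfold weighted_mass.
  set (F := fun x : R => x ^ 3 / 3 + a * x).
  replace ((beta ^ 3 - alpha ^ 3) / 3 + a * (beta - alpha))
    with (minus (F beta) (F alpha))
    by (unfold F, minus, plus, opp; simpl; field).
  apply is_RInt_unique, (is_RInt_derive F (quad_density a)).
  - intros x _. unfold F, quad_density. auto_derive; [easy | field].
  - intros x _. apply (ex_derive_continuous (quad_density a)).
    unfold quad_density. auto_derive. easy.
Qed.

Lemma interval_of_mass_quad (a M0 alpha beta : R) :
  interval_of_mass (quad_density a) M0 alpha beta <->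
  alpha <= beta /\
  (beta - alpha) ^ 3 + 3 * (beta - alpha) * (alpha * beta + a) = 3 * M0.
Proof.
  unfold interval_of_mass. rewrite quad_mass.
  split; intros [Hle Hm]; (split; [exact Hle | nra]).
Qed.

Lemma length_pos (a M0 alpha beta : R) :
  0 < M0 -> interval_of_mass (quad_density a) M0 alpha beta ->
  0 < beta - alpha.
Proof.
  intros hM0 H. apply interval_of_mass_quad in H as [Hle Hm].
  destruct (Req_dec (beta - alpha) 0) as [E | E]; [| lra].
  rewrite E in Hm. lra.
Qed.

(** The perimeter is [d ^ 2 + 2 * (alpha * beta + a)], and the mass constraint
    determines the last summand from [d]. *)
Lemma perimeter_of_length (a M0 alpha beta : R) :
  interval_of_mass (quad_density a) M0 alpha beta ->
  3 * (beta - alpha) * weighted_perimeter (quad_density a) alpha beta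
  = (beta - alpha) ^ 3 + 6 * M0.
Proof.
  intros H. apply interval_of_mass_quad in H as [_ Hm].
  unfold weighted_perimeter, quad_density. nra.
Qed.

(** From [4 * alpha * beta = (alpha + beta) ^ 2 - (beta - alpha) ^ 2].  The sign
    of the gap bounds the length, and its vanishing detects symmetry. *)
Lemma length_gap (a M0 alpha beta : R) :
  interval_of_mass (quad_density a) M0 alpha beta ->
  3 * M0 - ((beta - alpha) ^ 3 / 4 + 3 * a * (beta - alpha))
  = 3 / 4 * (beta - alpha) * (alpha + beta) ^ 2.
Proof.
  intros H. apply interval_of_mass_quad in H as [_ Hm]. rewrite <- Hm. field.
Qed.

Lemma length_constraint (a M0 alpha beta : R) :
  interval_of_mass (quad_density a) M0 alpha beta ->
  (beta - alpha) ^ 3 / 4 + 3 * a * (beta - alpha) <= 3 * M0.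
Proof.
  intros H. pose proof (length_gap _ _ _ _ H) as G. destruct H as [Hle _].
  pose proof (Rmult_le_pos (beta - alpha) ((alpha + beta) ^ 2)
                ltac:(lra) (pow2_ge_0 _)).
  lra.
Qed.

Lemma length_constraint_le (a x y : R) :
  0 < a ->
  x ^ 3 / 4 + 3 * a * x <= y ^ 3 / 4 + 3 * a * y -> x <= y.
Proof.
  intros ha H. apply Rnot_lt_le. intros Hlt.
  assert (E : x ^ 3 / 4 + 3 * a * x - (y ^ 3 / 4 + 3 * a * y)
          = (x - y) * (((x + y / 2) ^ 2 + 3 / 4 * y ^ 2) / 4 + 3 * a)) by field.
  assert (0 < (x - y) * (((x + y / 2) ^ 2 + 3 / 4 * y ^ 2) / 4 + 3 * a)).
  { apply Rmult_lt_0_compat; [lra |].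
    pose proof (pow2_ge_0 (x + y / 2)). pose proof (pow2_ge_0 y). lra. }
  lra.
Qed.

Lemma is_least_perimeter_intro (rho : R -> R) (M0 P alpha beta : R) :
  interval_of_mass rho M0 alpha beta ->
  weighted_perimeter rho alpha beta = P ->
  (forall alpha' beta', interval_of_mass rho M0 alpha' beta' ->
     P <= weighted_perimeter rho alpha' beta') ->
  is_least_perimeter rho M0 P.
Proof.
  intros Hm HP Hlow. exists alpha, beta. split; [split |]; trivial.
  rewrite HP. exact Hlow.
Qed.

(** * The unconstrained optimal length *)

(** This is the factorization behind the minimum of the perimeter at
    [d = c]. *)
Lemma perimeter_excess (a M0 c alpha beta : R) :
  c ^ 3 = 3 * M0 ->
  interval_of_mass (quad_density a) M0 alpha beta ->
  3 * (beta - alpha) * (weighted_perimeter (quad_density a) alpha beta - c ^ 2)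
  = (beta - alpha - c) ^ 2 * (beta - alpha + 2 * c).
Proof.
  intros Hc H. pose proof (perimeter_of_length _ _ _ _ H) as E.
  rewrite Rmult_minus_distr_l, E.
  replace (6 * M0) with (2 * c ^ 3) by lra. ring.
Qed.

Lemma perimeter_ge (a M0 c alpha beta : R) :
  0 < M0 -> 0 < c -> c ^ 3 = 3 * M0 ->
  interval_of_mass (quad_density a) M0 alpha beta ->
  c ^ 2 <= weighted_perimeter (quad_density a) alpha beta.
Proof.
  intros hM0 hc Hc H.
  pose proof (length_pos _ _ _ _ hM0 H) as Hd.
  pose proof (perimeter_excess _ _ _ _ _ Hc H) as E.
  pose proof (Rmult_le_pos _ (beta - alpha + 2 * c)
                (pow2_ge_0 (beta - alpha - c)) ltac:(lra)).
  nra.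
Qed.

Lemma perimeter_le_length (a M0 c alpha beta : R) :
  0 < M0 -> 0 < c -> c ^ 3 = 3 * M0 ->
  interval_of_mass (quad_density a) M0 alpha beta ->
  weighted_perimeter (quad_density a) alpha beta <= c ^ 2 ->
  beta - alpha = c.
Proof.
  intros hM0 hc Hc H HP.
  pose proof (length_pos _ _ _ _ hM0 H) as Hd.
  pose proof (perimeter_excess _ _ _ _ _ Hc H) as E.
  destruct (Req_dec (beta - alpha) c) as [| N]; [assumption |].
  assert (0 < (beta - alpha - c) ^ 2 * (beta - alpha + 2 * c)).
  { apply Rmult_lt_0_compat; [| lra]. apply pow2_gt_0. lra. }
  nra.
Qed.

(** Prescribing [beta - alpha = c] and [alpha * beta = - a] forces
    [(alpha + beta) ^ 2 = c ^ 2 - 4 * a], which can be solved precisely when the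
    right side is nonnegative. *)
Lemma optimal_length_attained (a M0 c : R) :
  0 < c -> c ^ 3 = 3 * M0 -> 4 * a <= c ^ 2 ->
  exists alpha beta,
    interval_of_mass (quad_density a) M0 alpha beta /\
    weighted_perimeter (quad_density a) alpha beta = c ^ 2.
Proof.
  intros hc Hc Ha.
  set (s := sqrt (c ^ 2 - 4 * a)).
  assert (Hs : s ^ 2 = c ^ 2 - 4 * a) by (apply pow2_sqrt; lra).
  assert (Hd : (s + c) / 2 - (s - c) / 2 = c) by field.
  assert (Hp : (s - c) / 2 * ((s + c) / 2) = - a).
  { replace ((s - c) / 2 * ((s + c) / 2)) with ((s ^ 2 - c ^ 2) / 4) by field.
    lra. }
  exists ((s - c) / 2), ((s + c) / 2). split.
  - apply interval_of_mass_quad. split; [lra |]. rewrite Hd, Hp. lra.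
  - unfold weighted_perimeter, quad_density. lra.
Qed.

Lemma is_least_perimeter_straddling (a M0 c : R) :
  0 < M0 -> 0 < c -> c ^ 3 = 3 * M0 -> 4 * a <= c ^ 2 ->
  is_least_perimeter (quad_density a) M0 (c ^ 2).
Proof.
  intros hM0 hc Hc Ha.
  destruct (optimal_length_attained a M0 c hc Hc Ha) as [al [be [Hm HP]]].
  apply (is_least_perimeter_intro _ _ _ al be Hm HP).
  intros al' be' H. exact (perimeter_ge a M0 c al' be' hM0 hc Hc H).
Qed.

Lemma least_perimeter_straddles (a M0 c alpha beta : R) :
  0 < a -> 0 < M0 -> 0 < c -> c ^ 3 = 3 * M0 -> 4 * a <= c ^ 2 ->
  least_perimeter_interval (quad_density a) M0 alpha beta ->
  alpha < 0 < beta /\ alpha * beta = - a.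
Proof.
  intros ha hM0 hc Hc Ha [Hm Hmin].
  destruct (optimal_length_attained a M0 c hc Hc Ha) as [al [be [Hm' HP]]].
  pose proof (Hmin _ _ Hm') as Hle. rewrite HP in Hle.
  pose proof (perimeter_le_length a M0 c alpha beta hM0 hc Hc Hm Hle) as Hd.
  apply interval_of_mass_quad in Hm as [_ Hm]. rewrite Hd in Hm.
  assert (Hp : alpha * beta = - a).
  { assert (E : c * (alpha * beta + a) = 0) by lra.
    apply Rmult_integral in E. lra. }
  split; [split; nra | exact Hp].
Qed.

(** * The symmetric interval *)

Lemma symmetric_interval (a M0 b : R) :
  0 <= b -> 2 * b ^ 3 + 6 * a * b = 3 * M0 ->
  interval_of_mass (quad_density a) M0 (- b) b /\
  weighted_perimeter (quad_density a) (- b) b = 2 * b ^ 2 + 2 * a.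
Proof.
  intros hb Hb. split.
  - apply interval_of_mass_quad. split; [lra |]. rewrite <- Hb. ring.
  - unfold weighted_perimeter, quad_density. ring.
Qed.

(** Past the critical density the symmetric interval, of length [2 * b], is the
    longest one and is still no longer than [c]. *)
Lemma length_bounds (a M0 c b alpha beta : R) :
  0 < a -> 0 < M0 -> 0 < c -> c ^ 3 = 3 * M0 -> c ^ 2 <= 4 * a ->
  2 * b ^ 3 + 6 * a * b = 3 * M0 ->
  interval_of_mass (quad_density a) M0 alpha beta ->
  0 < beta - alpha /\ beta - alpha <= 2 * b /\ 2 * b <= c.
Proof.
  intros ha hM0 hc Hc Ha Hb H.
  split; [exact (length_pos a M0 alpha beta hM0 H) |].
  split; apply (length_constraint_le a _ _ ha).
  - pose proof (length_constraint _ _ _ _ H). lra.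
  - nra.
Qed.

(** For [d <= D <= c] the perimeters differ, up to the positive factor
    [3 * d * D], by [(D - d) * (2 * c ^ 3 - d * D * (d + D))], and the last
    factor is positive when [d < D]. *)
Lemma symmetric_perimeter_lt (a M0 c b alpha beta : R) :
  0 < a -> 0 < M0 -> 0 < c -> c ^ 3 = 3 * M0 -> c ^ 2 <= 4 * a ->
  2 * b ^ 3 + 6 * a * b = 3 * M0 ->
  interval_of_mass (quad_density a) M0 alpha beta ->
  beta - alpha <> 2 * b ->
  2 * b ^ 2 + 2 * a < weighted_perimeter (quad_density a) alpha beta.
Proof.
  intros ha hM0 hc Hc Ha Hb H Hne.
  destruct (length_bounds a M0 c b alpha beta ha hM0 hc Hc Ha Hb H)
    as [Hd [HdD HDc]].
  pose proof (perimeter_of_length _ _ _ _ H) as E.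
  destruct (symmetric_interval a M0 b ltac:(lra) Hb) as [HS PS].
  pose proof (perimeter_of_length _ _ _ _ HS) as ES. rewrite PS in ES.
  set (P := weighted_perimeter (quad_density a) alpha beta) in *.
  set (Q := 2 * b ^ 2 + 2 * a) in *.
  replace (b - - b) with (2 * b) in ES by ring.
  set (d := beta - alpha) in *. set (D := 2 * b) in *.
  assert (HX : d * D * (d + D) < 2 * c ^ 3).
  { assert (d < c) by lra.
    assert (d * D < c * c) by nra.
    assert (0 < d * D) by (apply Rmult_lt_0_compat; lra).
    assert (d * D * (d + D) < c * c * (c + c))
      by (apply Rmult_le_0_lt_compat; lra).
    replace (2 * c ^ 3) with (c * c * (c + c)) by ring. assumption. }
  assert (EE : 3 * d * D * (P - Q) = (D - d) * (2 * c ^ 3 - d * D * (d + D))).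
  { replace (3 * d * D * (P - Q))
      with (D * (3 * d * P) - d * (3 * D * Q)) by ring.
    rewrite E, ES. replace (6 * M0) with (2 * c ^ 3) by lra. ring. }
  assert (0 < (D - d) * (2 * c ^ 3 - d * D * (d + D)))
    by (apply Rmult_lt_0_compat; lra).
  assert (0 < 3 * d * D) by (apply Rmult_lt_0_compat; lra).
  nra.
Qed.

(** An interval as long as the symmetric one leaves no gap in the length
    constraint. *)
Lemma symmetric_of_length (a M0 b alpha beta : R) :
  0 < M0 -> 2 * b ^ 3 + 6 * a * b = 3 * M0 ->
  interval_of_mass (quad_density a) M0 alpha beta ->
  beta - alpha = 2 * b -> alpha = - beta.
Proof.
  intros hM0 Hb H Hd.
  pose proof (length_pos _ _ _ _ hM0 H) as Hpos.
  pose proof (length_gap _ _ _ _ H) as G. rewrite Hd in G.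
  assert (E : b * (alpha + beta) ^ 2 = 0) by nra.
  apply Rmult_integral in E. destruct E as [E | E]; [lra |]. nra.
Qed.

Lemma is_least_perimeter_symmetric (a M0 c b : R) :
  0 < a -> 0 < M0 -> 0 < c -> c ^ 3 = 3 * M0 -> c ^ 2 <= 4 * a ->
  0 <= b -> 2 * b ^ 3 + 6 * a * b = 3 * M0 ->
  is_least_perimeter (quad_density a) M0 (2 * b ^ 2 + 2 * a).
Proof.
  intros ha hM0 hc Hc Ha hb Hb.
  destruct (symmetric_interval a M0 b hb Hb) as [HS PS].
  apply (is_least_perimeter_intro _ _ _ (- b) b HS PS).
  intros al be H. destruct (Req_dec (be - al) (2 * b)) as [E | N].
  - pose proof (symmetric_of_length a M0 b al be hM0 Hb H E) as Hs.
    replace be with b by lra. replace al with (- b) by lra. lra.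
  - left. exact (symmetric_perimeter_lt a M0 c b al be ha hM0 hc Hc Ha Hb H N).
Qed.

Lemma least_perimeter_symmetric (a M0 c b alpha beta : R) :
  0 < a -> 0 < M0 -> 0 < c -> c ^ 3 = 3 * M0 -> c ^ 2 <= 4 * a ->
  0 <= b -> 2 * b ^ 3 + 6 * a * b = 3 * M0 ->
  least_perimeter_interval (quad_density a) M0 alpha beta ->
  alpha = - beta.
Proof.
  intros ha hM0 hc Hc Ha hb Hb [Hm Hmin].
  destruct (symmetric_interval a M0 b hb Hb) as [HS PS].
  pose proof (Hmin _ _ HS) as Hle. rewrite PS in Hle.
  apply (symmetric_of_length a M0 b alpha beta hM0 Hb Hm).
  destruct (Req_dec (beta - alpha) (2 * b)) as [E | N]; [exact E |].
  pose proof (symmetric_perimeter_lt a M0 c b alpha beta ha hM0 hc Hc Ha Hb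
                Hm N).
  lra.
Qed.

(** * Fractional powers and Cardano's parameter *)

Lemma Rpower_nat_mult (x y : R) (n : nat) :
  Rpower x (y * INR n) = Rpower x y ^ n.
Proof. now rewrite <- Rpower_mult, Rpower_pow by apply exp_pos. Qed.

Lemma Rpower_third_cube (x : R) : 0 < x -> Rpower x (/ 3) ^ 3 = x.
Proof.
  intros hx. rewrite <- Rpower_nat_mult.
  replace (/ 3 * INR 3) with 1 by (simpl; field). now apply Rpower_1.
Qed.

Lemma Rpower_two_thirds (x : R) : Rpower x (2 / 3) = Rpower x (/ 3) ^ 2.
Proof. rewrite <- Rpower_nat_mult. f_equal. simpl; field. Qed.

Lemma Rpower_three_halves (x : R) : 0 < x -> Rpower x (3 / 2) = sqrt x ^ 3.
Proof.
  intros hx. rewrite <- Rpower_sqrt, <- Rpower_nat_mult by exact hx.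
  f_equal. simpl; field.
Qed.

Lemma is_k_unique_exists (a M0 : R) : 0 < M0 -> exists! k, is_k a M0 k.
Proof.
  intros hM0. unfold is_k.
  set (W := 3 * M0 + sqrt (9 * M0 ^ 2 + 16 * a ^ 3)).
  assert (HW : 0 < W / 4).
  { unfold W. pose proof (sqrt_pos (9 * M0 ^ 2 + 16 * a ^ 3)). lra. }
  exists (Rpower (W / 4) (2 / 3)). split; [split |].
  - apply exp_pos.
  - rewrite Rpower_mult. replace (2 / 3 * (3 / 2)) with 1 by field.
    rewrite Rpower_1 by exact HW. field.
  - intros k [hk Hk].
    replace (W / 4) with (Rpower k (3 / 2)) by lra.
    rewrite Rpower_mult. replace (3 / 2 * (2 / 3)) with 1 by field.
    now apply Rpower_1.
Qed.

(** Cardano's substitution [b = s - a / s] turns [b ^ 3 + 3 * a * b] into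
    [s ^ 3 - a ^ 3 / s ^ 3], so the cubic for [b] becomes a quadratic equation
    for [s ^ 3]; its positive root is [k ^ (3 / 2)], whence [s = sqrt k]. *)
Lemma cardano_half_length (a M0 k : R) :
  0 < a -> 0 < M0 -> is_k a M0 k ->
  exists b : R, 0 <= b /\ 2 * b ^ 3 + 6 * a * b = 3 * M0 /\
    2 * b ^ 2 + 2 * a = 2 * k + 2 * a ^ 2 / k - 2 * a.
Proof.
  intros ha hM0 [hk Hk]. rewrite Rpower_three_halves in Hk by exact hk.
  set (w := sqrt (9 * M0 ^ 2 + 16 * a ^ 3)) in *.
  assert (Hw : w ^ 2 = 9 * M0 ^ 2 + 16 * a ^ 3).
  { apply pow2_sqrt. pose proof (pow_lt a 3 ha). nra. }
  pose proof (sqrt_lt_R0 k hk) as hs.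
  pose proof (pow2_sqrt k ltac:(lra)) as Hs.
  set (s := sqrt k) in *.
  assert (Hq : 2 * (s ^ 3) ^ 2 - 3 * M0 * s ^ 3 = 2 * a ^ 3).
  { replace w with (4 * s ^ 3 - 3 * M0) in Hw by lra. nra. }
  assert (Hb : 2 * (s - a / s) ^ 3 + 6 * a * (s - a / s) = 3 * M0).
  { replace (2 * (s - a / s) ^ 3 + 6 * a * (s - a / s))
      with ((2 * (s ^ 3) ^ 2 - 2 * a ^ 3) / s ^ 3) by (field; lra).
    rewrite <- Hq. field. lra. }
  exists (s - a / s). split; [| split; [exact Hb |]].
  - apply Rnot_lt_le. intros Hneg. set (b := s - a / s) in *.
    pose proof (pow2_ge_0 b). nra.
  - rewrite <- Hs. field. lra.
Qed.

Theorem lemma3 (a M0 : R) (ha : 0 < a) (hM0 : 0 < M0) :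
  (forall alpha beta : R,
     least_perimeter_interval (quad_density a) M0 alpha beta ->
     (a < a_crit M0 -> alpha < 0 < beta /\ alpha * beta = - a) /\
     (a_crit M0 <= a -> alpha = - beta)) /\
  (exists! k : R, is_k a M0 k) /\
  (forall k : R, is_k a M0 k ->
     (a <= a_crit M0 ->
        is_least_perimeter (quad_density a) M0 (Rpower (3 * M0) (2 / 3))) /\
     (a_crit M0 <= a ->
        is_least_perimeter (quad_density a) M0
          (2 * k + 2 * a ^ 2 / k - 2 * a))).
Proof.
  unfold a_crit. rewrite Rpower_two_thirds.
  assert (hc : 0 < Rpower (3 * M0) (/ 3)) by apply exp_pos.
  assert (Hc : Rpower (3 * M0) (/ 3) ^ 3 = 3 * M0)
    by (apply Rpower_third_cube; lra).
  set (c := Rpower (3 * M0) (/ 3)) in *.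
  pose proof (is_k_unique_exists a M0 hM0) as Hex.
  split; [| split; [exact Hex |]].
  - intros alpha beta H. split; intros Ha.
    + apply (least_perimeter_straddles a M0 c); trivial. lra.
    + destruct Hex as [k [Hk _]].
      destruct (cardano_half_length a M0 k ha hM0 Hk) as [b [hb [Hb _]]].
      apply (least_perimeter_symmetric a M0 c b); trivial. lra.
  - intros k Hk. split; intros Ha.
    + apply is_least_perimeter_straddling; trivial. lra.
    + destruct (cardano_half_length a M0 k ha hM0 Hk) as [b [hb [Hb HP]]].
      rewrite <- HP.
      apply (is_least_perimeter_symmetric a M0 c b); trivial. lra.
Qed.
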